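(* Let $k$ be a quadratically closed field. Then every element of $\mathrm{PSL}_2(k)$ can be written as a commutator of a unipotent element and a semisimple element.
   Context: A field is quadratically closed if it admits no quadratic extension. $\mathrm{PSL}_2(k)$ is the quotient of $\mathrm{SL}_2(k)$ by $\{\pm I\}$. The commutator is $[x,y]=xyx^{-1}y^{-1}$. Unipotent (respectively semisimple) elements of $\mathrm{PSL}_2(k)$ are images of unipotent (respectively semisimple) elements of $\mathrm{SL}_2(k)$, in the usual sense: semisimple means diagonalizable over an algebraic closure (central elements, in particular the identity, are allowed), and unipotent means all eigenvalues equal to $1$. *)

(* Defs.v *)
From HB Require Import structures.
From mathcomp Require Import all_boot all_algebra all_field.

Set Implicit Arguments.
Unset Strict Implicit.
Unset Printing Implicit Defensive.

Import GRing.Theory.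
Local Open Scope ring_scope.
Local Open Scope quotient_scope.

Definition quadratically_closed (k : fieldType) : Prop :=
  ~ exists L : fieldExtType k, \dim {:L} = 2%N.

(* A [closedFieldType] is algebraically closed, so with this condition [K] is
   an algebraic closure of [k] via [iota]. *)
Definition algebraic_closure (k : fieldType) (K : closedFieldType)
    (iota : {rmorphism k -> K}) : Prop :=
  forall z : K, algebraicOver iota z.

(* [commg] is x^-1 * y^-1 * x * y, a different convention. *)
Definition commutator (G : groupType) (x y : G) : G :=
  (x * y * x^-1 * y^-1)%g.

Record SL2 (k : fieldType) := MkSL2 {
  SL2_val :> 'M[k]_2;
  _ : \det SL2_val == 1
}.

HB.instance Definition _ (k : fieldType) := [isSub for @SL2_val k].
HB.instance Definition _ (k : fieldType) := [Choice of SL2 k by <:].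

Section SL2Group.
Variable k : fieldType.
Implicit Types A B C : SL2 k.

Lemma SL2_det A : \det (val A) = 1.
Proof. exact/eqP/(valP A). Qed.

Lemma SL2_unit A : val A \in unitmx.
Proof. by rewrite unitmxE SL2_det unitr1. Qed.

Fact SL2_mul_subproof A B : \det (val A *m val B) == 1.
Proof. by rewrite det_mulmx !SL2_det mulr1. Qed.
Definition SL2_mul A B : SL2 k := MkSL2 (SL2_mul_subproof A B).

Fact SL2_one_subproof : \det (1%:M : 'M[k]_2) == 1.
Proof. by rewrite det1. Qed.
Definition SL2_one : SL2 k := MkSL2 SL2_one_subproof.

Fact SL2_inv_subproof A : \det (invmx (val A)) == 1.
Proof. by rewrite det_inv SL2_det invr1. Qed.
Definition SL2_inv A : SL2 k := MkSL2 (SL2_inv_subproof A).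

Fact SL2_mulA : associative SL2_mul.
Proof. by move=> A B C; apply/val_inj; rewrite /= mulmxA. Qed.
Fact SL2_mul1g : left_id SL2_one SL2_mul.
Proof. by move=> A; apply/val_inj; rewrite /= mul1mx. Qed.
Fact SL2_mulg1 : right_id SL2_one SL2_mul.
Proof. by move=> A; apply/val_inj; rewrite /= mulmx1. Qed.
Fact SL2_mulVg : left_inverse SL2_one SL2_inv SL2_mul.
Proof. by move=> A; apply/val_inj; rewrite /= mulVmx ?SL2_unit. Qed.
Fact SL2_mulgV : right_inverse SL2_one SL2_inv SL2_mul.
Proof. by move=> A; apply/val_inj; rewrite /= mulmxV ?SL2_unit. Qed.

HB.instance Definition _ :=
  isGroup.Build (SL2 k) SL2_mulA SL2_mul1g SL2_mulg1 SL2_mulVg SL2_mulgV.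

Lemma val_SL2M A B : val (A * B)%g = val A *m val B. Proof. by []. Qed.
Lemma val_SL2V A : val A^-1%g = invmx (val A). Proof. by []. Qed.
Lemma val_SL21 : val (1%g : SL2 k) = 1%:M. Proof. by []. Qed.

Fact SL2_N1_subproof : \det (- 1%:M : 'M[k]_2) == 1.
Proof. by rewrite -scaleN1r detZ det1 mulr1 sqrrN expr1n. Qed.
Definition SL2_N1 : SL2 k := MkSL2 SL2_N1_subproof.

Definition SL2_pm1 : {pred SL2 k} := pred2 1%g SL2_N1.

Definition PSL2_rel : rel (SL2 k) := fun A B => (A^-1 * B)%g \in SL2_pm1.

Lemma PSL2_relE A B :
  PSL2_rel A B = (val B == val A) || (val B == - val A).
Proof.
have E C : (A^-1 * B == C)%g = (B == A * C)%g.
  by apply/eqP/eqP => [<-|->]; rewrite ?mulVKg ?mulKg.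
rewrite /PSL2_rel !inE !E mulg1 -!val_eqE /=.
by rewrite mulmxN mulmx1.
Qed.

Fact PSL2_rel_refl : reflexive PSL2_rel.
Proof. by move=> A; rewrite PSL2_relE eqxx. Qed.
Fact PSL2_rel_sym : symmetric PSL2_rel.
Proof.
by move=> A B; rewrite !PSL2_relE eq_sym [val B == - _]eq_sym eqr_oppLR.
Qed.
Fact PSL2_rel_trans : transitive PSL2_rel.
Proof.
move=> B A C; rewrite !PSL2_relE => /orP[]/eqP-> /orP[]/eqP->;
  by rewrite ?opprK eqxx ?orbT.
Qed.

Canonical PSL2_equiv :=
  EquivRel PSL2_rel PSL2_rel_refl PSL2_rel_sym PSL2_rel_trans.

Definition PSL2 := {eq_quot PSL2_rel}.
HB.instance Definition _ := Choice.on PSL2.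
HB.instance Definition _ : EqQuotient _ PSL2_equiv PSL2 := EqQuotient.on PSL2.

Lemma PSL2_piP A B :
  reflect (\pi_PSL2 A = \pi_PSL2 B) (PSL2_rel A B).
Proof. by rewrite -(eqquotE PSL2); exact: eqP. Qed.

Definition PSL2_mul : PSL2 -> PSL2 -> PSL2 := lift_op2 PSL2 (fun A B => (A * B)%g).
Definition PSL2_one : PSL2 := lift_cst PSL2 1%g.
Definition PSL2_inv : PSL2 -> PSL2 := lift_op1 PSL2 (fun A => A^-1%g).

Lemma pi_PSL2M : {morph \pi_PSL2 : A B / (A * B)%g >-> PSL2_mul A B}.
Proof.
move=> A B; unlock PSL2_mul; apply/PSL2_piP; rewrite PSL2_relE !val_SL2M.
have /PSL2_piP := reprK (\pi_PSL2 A); have /PSL2_piP := reprK (\pi_PSL2 B).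
rewrite !PSL2_relE => /orP[]/eqP-> /orP[]/eqP->;
  by rewrite ?mulmxN ?mulNmx ?opprK eqxx ?orbT.
Qed.

Lemma pi_PSL2V : {morph \pi_PSL2 : A / A^-1%g >-> PSL2_inv A}.
Proof.
move=> A; unlock PSL2_inv; apply/PSL2_piP; rewrite PSL2_relE !val_SL2V.
have /PSL2_piP := reprK (\pi_PSL2 A).
rewrite !PSL2_relE => /orP[]/eqP->; first by rewrite eqxx.
have UN B : -1 *: val B \in unitmx by rewrite unitmxZ ?unitrN1 ?SL2_unit.
by rewrite -scaleN1r invmxZ // invrN1 scaleN1r opprK eqxx orbT.
Qed.

Lemma pi_PSL21 : \pi_PSL2 1%g = PSL2_one.
Proof. by unlock PSL2_one. Qed.

Fact PSL2_mulA : associative PSL2_mul.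
Proof.
by elim/quotW=> A; elim/quotW=> B; elim/quotW=> C; rewrite -!pi_PSL2M mulgA.
Qed.
Fact PSL2_mul1g : left_id PSL2_one PSL2_mul.
Proof. by elim/quotW=> A; rewrite -pi_PSL21 -pi_PSL2M mul1g. Qed.
Fact PSL2_mulg1 : right_id PSL2_one PSL2_mul.
Proof. by elim/quotW=> A; rewrite -pi_PSL21 -pi_PSL2M mulg1. Qed.
Fact PSL2_mulVg : left_inverse PSL2_one PSL2_inv PSL2_mul.
Proof. by elim/quotW=> A; rewrite -pi_PSL2V -pi_PSL2M mulVg pi_PSL21. Qed.
Fact PSL2_mulgV : right_inverse PSL2_one PSL2_inv PSL2_mul.
Proof. by elim/quotW=> A; rewrite -pi_PSL2V -pi_PSL2M mulgV pi_PSL21. Qed.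

HB.instance Definition _ :=
  isGroup.Build PSL2 PSL2_mulA PSL2_mul1g PSL2_mulg1 PSL2_mulVg PSL2_mulgV.

Lemma PSL2_piM A B : \pi_PSL2 (A * B)%g = (\pi_PSL2 A * \pi_PSL2 B)%g.
Proof. exact: pi_PSL2M. Qed.
Lemma PSL2_piV A : \pi_PSL2 A^-1%g = (\pi_PSL2 A)^-1%g.
Proof. exact: pi_PSL2V. Qed.

End SL2Group.

(* In these four definitions [iota] is meant to embed [k] in an algebraic
   closure [K]. *)
Definition SL2_unipotent (k : fieldType) (K : closedFieldType)
    (iota : {rmorphism k -> K}) (A : SL2 k) : Prop :=
  forall a : K, eigenvalue (map_mx iota (val A)) a -> a = 1.

Definition SL2_semisimple (k : fieldType) (K : closedFieldType)
    (iota : {rmorphism k -> K}) (A : SL2 k) : Prop :=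
  diagonalizable (map_mx iota (val A)).

Definition PSL2_unipotent (k : fieldType) (K : closedFieldType)
    (iota : {rmorphism k -> K}) (g : PSL2 k) : Prop :=
  exists2 A : SL2 k, SL2_unipotent iota A & g = \pi_(PSL2 k) A.

Definition PSL2_semisimple (k : fieldType) (K : closedFieldType)
    (iota : {rmorphism k -> K}) (g : PSL2 k) : Prop :=
  exists2 A : SL2 k, SL2_semisimple iota A & g = \pi_(PSL2 k) A.

(* Main.v *)
Require Import Defs.
From HB Require Import structures.
From mathcomp Require Import all_boot all_algebra all_field.
From mathcomp Require Import ring.
From Stdlib Require Import Classical.

Set Implicit Arguments.
Unset Strict Implicit.
Unset Printing Implicit Defensive.

Import GRing.Theory.
Local Open Scope ring_scope.
Local Open Scope quotient_scope.

(** A non-scalar 2x2 matrix has a cyclic vector, so two non-scalar elements of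
    SL_2(k) with equal traces are conjugate in GL_2(k), hence in SL_2(k) when
    square roots exist. It thus suffices to find, for each trace t, a non-scalar
    commutator [u, s] of trace t. With u = [1 1; 0 1], the choice
    s = [0 -1/c; c d] gives [u, s] = [1+c^2 1; c^2 1], of trace 2 + c^2, with d
    free to make s semisimple; this covers every t other than 2, and a diagonal
    s covers t = 2. *)

Section Matrix2.
Variable R : comNzRingType.

Definition mx2 (a b c d : R) : 'M[R]_2 :=
  \matrix_(i, j) if i == 0 then if j == 0 then a else b
                 else if j == 0 then c else d.

Lemma mx2_eta (A : 'M[R]_2) : A = mx2 (A 0 0) (A 0 1) (A 1 0) (A 1 1).
Proof.
by apply/matrixP=> -[[|[|//]] ?] [[|[|//]] ?]; rewrite mxE /=;
  congr (A _ _); apply/val_inj.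
Qed.

Lemma mulmx_mx2 a b c d a' b' c' d' :
  mx2 a b c d *m mx2 a' b' c' d' =
  mx2 (a * a' + b * c') (a * b' + b * d') (c * a' + d * c') (c * b' + d * d').
Proof.
by apply/matrixP=> -[[|[|//]] ?] [[|[|//]] ?];
  rewrite !mxE !big_ord_recl big_ord0 !mxE /= addr0.
Qed.

Lemma det_mx2 a b c d : \det (mx2 a b c d) = a * d - b * c.
Proof.
rewrite (expand_det_row _ 0) !big_ord_recl big_ord0 /cofactor !det_mx11 !mxE /=.
by ring.
Qed.

Lemma mxtrace_mx2 a b c d : \tr (mx2 a b c d) = a + d.
Proof. by rewrite /mxtrace !big_ord_recl big_ord0 !mxE /= addr0. Qed.

Lemma is_scalar_mx2 a b c d :
  is_scalar_mx (mx2 a b c d) = [&& a == d, b == 0 & c == 0].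
Proof.
apply/is_scalar_mxP/and3P => [[x /matrixP e]|[/eqP-> /eqP-> /eqP->]].
  move: (e 0 0) (e 0 1) (e 1 0) (e 1 1).
  by rewrite !mxE /= !mulr1n !mulr0n => -> -> -> ->; rewrite !eqxx.
exists d; apply/matrixP=> -[[|[|//]] ?] [[|[|//]] ?];
  by rewrite !mxE /= ?mulr1n ?mulr0n.
Qed.

End Matrix2.

(** In a basis [v], [A v], Cayley-Hamilton gives [A (A v) = tr A * A v - det A * v], so the matrix
    becomes the companion matrix of its characteristic polynomial. *)
Lemma nonscalar_mx2_companion (F : fieldType) (A : 'M[F]_2) :
  ~~ is_scalar_mx A ->
  exists2 P, P \in unitmx & A *m P = P *m mx2 0 (- \det A) 1 (\tr A).
Proof.
rewrite (mx2_eta A); move: (A 0 0) (A 0 1) (A 1 0) (A 1 1) => a b c d.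
rewrite is_scalar_mx2 det_mx2 mxtrace_mx2.
(* In each case the columns of [P] are a cyclic vector and its image. *)
have [c0 | c_nz _] := eqVneq c 0; last first.
  exists (mx2 1 a 0 c); first by rewrite unitmxE det_mx2 unitfE mul1r mulr0 subr0.
  by rewrite !mulmx_mx2; congr mx2; ring.
have [b0 | b_nz _] := eqVneq b 0; last first.
  exists (mx2 0 b 1 d).
    by rewrite unitmxE det_mx2 unitfE mul0r mulr1 sub0r oppr_eq0.
  by rewrite !mulmx_mx2; congr mx2; ring.
rewrite !andbT => neq_ad; exists (mx2 1 a 1 d).
  by rewrite unitmxE det_mx2 unitfE mul1r mulr1 subr_eq0 eq_sym.
by rewrite b0 c0 !mulmx_mx2; congr mx2; ring.
Qed.

(** A quadratic without roots is irreducible, so adjoining a root would produce a forbidden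
    extension of degree 2. *)
Lemma quadratically_closed_root (k : fieldType) :
  quadratically_closed k -> forall p q : k, exists x, x ^+ 2 + p * x + q = 0.
Proof.
move=> hk p q; apply: NNPP => no_root; apply: hk.
pose f : {poly k} := 'X ^+ 2 + (p *: 'X + q%:P).
have sz_f : size f = 3.
  rewrite size_polyDl size_polyXn // ltnS (leq_trans (size_polyD _ _)) //.
  rewrite geq_max (leq_trans (size_scale_leq _ _)) ?size_polyX //.
  by rewrite (leq_trans (size_polyC_leq1 _)).
have irr_f : irreducible_poly f.
  apply: cubic_irreducible => [|x]; first by rewrite sz_f.
  apply/negP => /rootP f0; apply: no_root; exists x.
  by rewrite -addrA -[RHS]f0 /f !hornerE.
by have [L dimL _] := irredp_FAdjoin irr_f; exists L; rewrite dimL sz_f.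
Qed.

Section Conjugacy.
Variables (k : fieldType) (hk : quadratically_closed k).
Implicit Types A B : SL2 k.

(** Supplies a diagonal matrix with distinct entries [l], [l^-1]. In characteristic 2, [l] is a
    primitive cube root of unity; otherwise it is a square root of -1. *)
Lemma quadratically_closed_sqr_neq1 : exists2 l : k, l != 0 & l ^+ 2 != 1.
Proof.
have [two0 | two_nz] := eqVneq (2 : k) 0.
  have [l] := quadratically_closed_root hk 1 1; rewrite mul1r => l_eq.
  exists l; apply/eqP => l1.
    by move/eqP: l_eq; rewrite l1 expr0n !add0r oner_eq0.
  have l0 : l = 0 by move: l_eq; rewrite l1 addrAC -mulr2n two0 add0r.
  by move/eqP: l1; rewrite l0 expr0n eq_sym oner_eq0.
have [l] := quadratically_closed_root hk 0 1; rewrite mul0r addr0 => l_eq.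
exists l; apply/eqP => l1.
  by move/eqP: l_eq; rewrite l1 expr0n add0r oner_eq0.
by move/eqP: l_eq; rewrite l1; apply/negP.
Qed.

(** Both matrices are similar to the same companion matrix [C], so [S], built from the two base
    changes, satisfies [A S = S B]. *)
Lemma SL2_conj A B :
  ~~ is_scalar_mx (val A) -> ~~ is_scalar_mx (val B) ->
  \tr (val A) = \tr (val B) -> exists h : SL2 k, (A ^ h)%g = B.
Proof.
move=> /nonscalar_mx2_companion[P uP AP] /nonscalar_mx2_companion[Q uQ BQ] trAB.
rewrite SL2_det trAB in AP; rewrite SL2_det in BQ.
set C := mx2 _ _ _ _ in AP BQ.
pose S := P *m invmx Q.
have AS : val A *m S = S *m val B.
  rewrite mulmxA AP -!mulmxA; congr (P *m _).
  by apply: (canLR (mulmxK uQ)); rewrite -!mulmxA BQ mulKmx.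
have dS : \det S != 0 by rewrite -unitfE -unitmxE unitmx_mul uP unitmx_inv.
(* Scaling keeps the relation [A S = S B] and multiplies the determinant by [r ^+ 2], so a square
   root of [(\det S)^-1] brings [S] into SL_2. *)
have [r /eqP] := quadratically_closed_root hk 0 (- (\det S)^-1).
rewrite mul0r addr0 subr_eq0 => /eqP r_eq.
have dh : \det (r *: S) == 1 by rewrite detZ r_eq mulVf.
exists (MkSL2 dh); rewrite conjgE; apply: (canLR (mulKg _)); apply: val_inj.
by rewrite !val_SL2M /= -scalemxAr AS -scalemxAl.
Qed.

End Conjugacy.

Section Geometric.
Variables (k : fieldType) (K : closedFieldType) (iota : {rmorphism k -> K}).
Implicit Types A h : SL2 k.

Lemma map_SL2_unit A : map_mx iota (val A) \in unitmx.
Proof. by rewrite map_unitmx SL2_unit. Qed.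

Lemma map_SL2J A h : map_mx iota (val (A ^ h)%g) =
  invmx (map_mx iota (val h)) *m map_mx iota (val A) *m map_mx iota (val h).
Proof. by rewrite conjgE !val_SL2M val_SL2V !map_mxM map_invmx mulmxA. Qed.

Lemma SL2_unipotentJ A h :
  SL2_unipotent iota A -> SL2_unipotent iota (A ^ h)%g.
Proof.
move=> uA a /eigenvalueP[v]; rewrite map_SL2J => v_eq v_nz; apply: uA.
apply/eigenvalueP; exists (v *m invmx (map_mx iota (val h))).
  by rewrite scalemxAl -v_eq !mulmxA mulmxK ?map_SL2_unit.
by apply: contraNneq v_nz => v0; rewrite -(mulmxKV (map_SL2_unit h) v) v0 mul0mx.
Qed.

Lemma SL2_semisimpleJ A h :
  SL2_semisimple iota A -> SL2_semisimple iota (A ^ h)%g.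
Proof.
have uh := map_SL2_unit h; case=> P uP dA.
exists (P *m map_mx iota (val h)); first by rewrite unitmx_mul uP.
by rewrite /similar_to conjuMumx // map_SL2J -conjVmx // conjmxVK.
Qed.

Lemma SL2_unipotent_mx2 A x : val A = mx2 1 x 0 1 -> SL2_unipotent iota A.
Proof.
(* If [a] is not 1, the two coordinates of the row equation force first [v 0 0], then [v 0 1], to
   vanish. *)
move=> eA a /eigenvalueP[v /matrixP v_eq]; apply: contra_neq_eq => a_neq1.
have a1_nz : 1 - a != 0 by rewrite subr_eq0 eq_sym.
move: (v_eq 0 0) (v_eq 0 1).
rewrite eA !mxE !big_ord_recl !big_ord0 !mxE /= !rmorph1 rmorph0.
have -> : lift ord0 ord0 = 1 :> 'I_2 by apply/val_inj.
rewrite !mulr1 mulr0 !addr0 => e0 e1.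
have v0 : v 0 0 = 0.
  by apply/(mulfI a1_nz); rewrite mulrBl mul1r mulr0 -e0 subrr.
apply/matrixP=> i; rewrite [i]ord1 => -[[|[|//]] ?].
  by rewrite [RHS]mxE -[RHS]v0; congr (v _ _); apply/val_inj.
have v1 : v 0 1 = 0.
  by apply/(mulfI a1_nz); rewrite mulrBl mul1r mulr0 -e1 v0 mul0r add0r subrr.
by rewrite [RHS]mxE -[RHS]v1; congr (v _ _); apply/val_inj.
Qed.

Lemma SL2_semisimple_diag A : is_diag_mx (val A) -> SL2_semisimple iota A.
Proof.
move=> dA; exists 1%:M; first exact: unitmx1.
rewrite /similar_to conj1mx; apply/is_diag_mxP => i j ij.
by rewrite mxE (is_diag_mxP dA) // rmorph0.
Qed.

(** Such a matrix is conjugate to diag([l], [l^-1]), which has the same trace and is non-scalar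
    because [l] differs from [l^-1]. *)
Lemma SL2_semisimple_trace (hk : quadratically_closed k) A l :
  ~~ is_scalar_mx (val A) -> l != 0 -> l ^+ 2 != 1 ->
  \tr (val A) = l + l^-1 -> SL2_semisimple iota A.
Proof.
move=> nsA l_nz l2 trA.
have dD : \det (mx2 l 0 0 l^-1) == 1 by rewrite det_mx2 mulfV // mulr0 subr0.
have [|||h <-] := @SL2_conj k hk (MkSL2 dD) A => //=.
- rewrite is_scalar_mx2 !eqxx !andbT; apply: contra l2 => /eqP e.
  by rewrite expr2 {2}e mulfV.
- by rewrite mxtrace_mx2 trA.
apply/SL2_semisimpleJ/SL2_semisimple_diag/is_diag_mxP => /=.
by move=> [[|[|//]] ?] [[|[|//]] ?] //=; rewrite mxE.
Qed.

End Geometric.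

(** Scalars are set apart because -I is not of this form outside characteristic 2: [u] would be
    conjugate to [-u], whose trace is -2 instead of 2. *)
Lemma SL2_commutator (k : fieldType) (K : closedFieldType)
    (iota : {rmorphism k -> K}) (hk : quadratically_closed k) (g : SL2 k) :
  ~~ is_scalar_mx (val g) ->
  exists u s : SL2 k,
    [/\ SL2_unipotent iota u, SL2_semisimple iota s & g = commutator u s].
Proof.
move=> ns_g; have [l l_nz l2] := quadratically_closed_sqr_neq1 hk.
have du : \det (mx2 1 1 0 1 : 'M[k]_2) == 1.
  by rewrite det_mx2 mulr1 mulr0 subr0.
pose u := MkSL2 du; have uu : SL2_unipotent iota u by exact: SL2_unipotent_mx2.
(* Conjugating [u] and [s] by the same [h] conjugates their commutator, so matching the trace of [g]
   is enough. *)
suff [s ss [ns_us tr_us]] : exists2 s : SL2 k, SL2_semisimple iota s &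
    ~~ is_scalar_mx (val (commutator u s)) /\
    \tr (val (commutator u s)) = \tr (val g).
  have [h <-] := SL2_conj hk ns_us ns_g tr_us.
  exists (u ^ h)%g, (s ^ h)%g; split.
  - exact: SL2_unipotentJ.
  - exact: SL2_semisimpleJ.
  by rewrite /commutator !conjMg !conjVg.
(* Clearing inverses reduces a commutator identity to a product of explicit matrices. *)
have commE (s w : SL2 k) : val u *m val s = val w *m val s *m val u ->
    commutator u s = w.
  move=> e; rewrite /commutator; apply: (canLR (mulgK s)).
  apply: (canLR (mulgK u)).
  by apply: val_inj; rewrite !val_SL2M.
have [t2 | t_neq2] := eqVneq (\tr (val g)) 2.
  (* Conjugation by this diagonal matrix multiplies the upper right entry of [u] by [l ^+ 2], so the
     commutator has entry [1 - l ^+ 2], which is nonzero. *)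
  have ds : \det (mx2 l 0 0 l^-1) == 1 by rewrite det_mx2 mulfV // mulr0 subr0.
  have dw : \det (mx2 1 (1 - l ^+ 2) 0 1) == 1.
    by rewrite det_mx2 mulr0 subr0 mulr1.
  exists (MkSL2 ds).
    apply/SL2_semisimple_diag/is_diag_mxP => /=.
    by move=> [[|[|//]] ?] [[|[|//]] ?] //=; rewrite mxE.
  rewrite (@commE _ (MkSL2 dw)); last first.
    by rewrite /= !mulmx_mx2; congr mx2; field.
  by rewrite /= is_scalar_mx2 mxtrace_mx2 subr_eq0 eq_sym (negbTE l2) andbF t2.
(* Chosen so that the commutator trace [2 + c ^+ 2] equals the trace of [g]. *)
have [c] := quadratically_closed_root hk 0 (2 - \tr (val g)).
rewrite mul0r addr0 => c_eq.
have c_nz : c != 0.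
  apply: contra_neq t_neq2 => c0.
  by move/eqP: c_eq; rewrite c0 expr0n add0r subr_eq0 => /eqP.
(* The trace of [s] is [d]; this value gives [s] the distinct eigenvalues [l] and [l^-1]. *)
pose d := l + l^-1.
have ds : \det (mx2 0 (- c^-1) c d) == 1.
  by rewrite det_mx2 mul0r mulNr mulVf // sub0r opprK.
have dw : \det (mx2 (1 + c ^+ 2) 1 (c ^+ 2) 1) == 1.
  by rewrite det_mx2 mulr1 mul1r addrK.
exists (MkSL2 ds).
  apply: (SL2_semisimple_trace _ hk _ l_nz l2).
    by rewrite /= is_scalar_mx2 (negbTE c_nz) !andbF.
  by rewrite /= mxtrace_mx2 add0r.
rewrite (@commE _ (MkSL2 dw)); last first.
  by rewrite /= !mulmx_mx2; congr mx2; field.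
rewrite /= is_scalar_mx2 mxtrace_mx2 oner_eq0 !andbF; split=> //.
by apply/eqP; rewrite -subr_eq0 -[X in _ == X]c_eq; apply/eqP; ring.
Qed.

Theorem theorem5p2 (k : fieldType) (K : closedFieldType)
    (iota : {rmorphism k -> K}) (hK : algebraic_closure iota)
    (hk : quadratically_closed k) (g : PSL2 k) :
  exists u s : PSL2 k,
    PSL2_unipotent iota u /\ PSL2_semisimple iota s /\ g = commutator u s.
Proof.
elim/quotW: g => g; have [sc_g | ns_g] := boolP (is_scalar_mx (val g)).
  (* A scalar of determinant 1 is I or -I, hence trivial in PSL_2, and the trivial commutator
     suffices. *)
  exists 1%g, 1%g; split; [|split].
  - exists 1%g; last by rewrite pi_PSL21.
    apply: (@SL2_unipotent_mx2 _ _ _ _ 0); rewrite (mx2_eta (val _)).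
    by rewrite val_SL21 !mxE.
  - exists 1%g; last by rewrite pi_PSL21.
    exact/SL2_semisimple_diag/scalar_mx_is_diag.
  rewrite /commutator invg1 !mulg1 -[RHS]pi_PSL21.
  apply/PSL2_piP; rewrite PSL2_rel_sym PSL2_relE val_SL21.
  have /is_scalar_mxP[a g_eq] := sc_g; have := SL2_det g.
  rewrite g_eq det_scalar => /eqP; rewrite sqrf_eq1 => /orP[] /eqP->.
    by rewrite eqxx.
  by rewrite raddfN eqxx orbT.
have [u [s [uu ss ->]]] := SL2_commutator iota hk ns_g.
exists (\pi_(PSL2 k) u), (\pi_(PSL2 k) s); split; first by exists u.
split; first by exists s.
by rewrite /commutator !PSL2_piM !PSL2_piV.
Qed.
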